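(* There exists an algorithm and an absolute constant $C$ such that, for every instance $\big(S,\mathcal{F},F^*,c,\ell,u,\operatorname{span}_w(\cdot)\big)$ of the bound-constrained minimum-cost inverse optimization problem under the weighted span objective, with $n=|S|$, the algorithm determines an optimal deviation vector if one exists (and otherwise reports that the problem is infeasible), using at most $C\cdot n^2\cdot\|w\|_{-1}^6$ calls to the oracle $\mathcal{O}$; that is, it uses $O(n^2\cdot\|w\|_{-1}^6)$ oracle calls.
   Context: An instance consists of a finite nonempty ground set $S$ of size $n$, a collection $\mathcal{F}\subseteq 2^S$ of feasible solutions, an input solution $F^*\in\mathcal{F}$, a cost function $c\in\mathbb{R}^S$, a positive weight function $w\in\mathbb{R}_+^S$, and bounds $\ell:S\to\mathbb{R}\cup\{-\infty\}$, $u:S\to\mathbb{R}\cup\{+\infty\}$ with $\ell\le u$. Standing assumption: $w$ is scaled so that $1/w(s)$ is an integer for each $s\in S$. Set $\|w\|_{-1}:=\sum_{s\in S}\frac1{w(s)}$. For $f\in\mathbb{R}^S$ and $X\subseteq S$, $f(X):=\sum_{s\in X}f(s)$. For $p\in\mathbb{R}^S$, $\operatorname{span}_w(p):=\max\{w(s)p(s)\mid s\in S\}-\min\{w(s)p(s)\mid s\in S\}$. A deviation vector $p\in\mathbb{R}^S$ is feasible if (a) $F^*$ is a minimum-cost member of $\mathcal{F}$ with respect to $c-p$, i.e. $(c-p)(F^* )\le(c-p)(F)$ for all $F\in\mathcal{F}$, and (b) $\ell\le p\le u$ coordinatewise. It is optimal if it is feasible and minimizes $\operatorname{span}_w(p)$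 among all feasible deviation vectors. The problem is infeasible if no feasible deviation vector exists. The algorithm is given $S,F^*,c,\ell,u,w$, and accesses $\mathcal{F}$ through an oracle $\mathcal{O}$ which, for any cost function $c'\in\mathbb{R}^S$, returns a member of $\mathcal{F}$ of minimum $c'$-cost. *)

(* Defs.v *)
(* MathComp world, with R : realType and \bar R from MathComp-Analysis. *)
From mathcomp Require Import all_boot all_order all_algebra.
From mathcomp Require Import reals constructive_ereal.

Set Implicit Arguments.
Unset Strict Implicit.
Unset Printing Implicit Defensive.

Import Order.TTheory GRing.Theory Num.Theory.
Local Open Scope ring_scope.

(** * Inverse optimization under the weighted span objective *)

Record instance (R : realType) (S : finType) := Instance {
  feas : {set {set S}};
  Fstar : {set S};
  cost : S -> R;
  weight : S -> R;
  lower : S -> \bar R;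
  upper : S -> \bar R
}.

Definition vsum (R : realType) (S : finType) (f : S -> R) (X : {set S}) : R :=
  \sum_(s in X) f s.

Definition wf_instance (R : realType) (S : finType) (I : instance R S) : Prop :=
  [/\ Fstar I \in feas I,
      forall s, 0 < weight I s,
      forall s, (weight I s)^-1 \is a Num.int &
      forall s, [/\ lower I s != +oo%E, upper I s != -oo%E
                  & (lower I s <= upper I s)%E]].

Definition wnorm (R : realType) (S : finType) (I : instance R S) : R :=
  \sum_s (weight I s)^-1.

(** [s0] only witnesses that [S] is nonempty: it occurs among the values of
    which the maximum and the minimum are taken, so the result does not depend
    on it. *)
Definition span (R : realType) (S : finType) (s0 : S) (I : instance R S)
    (p : S -> R) : R :=
  \big[Num.max/(weight I s0 * p s0)]_s (weight I s * p s)
  - \big[Num.min/(weight I s0 * p s0)]_s (weight I s * p s).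

Definition feasible (R : realType) (S : finType) (I : instance R S)
    (p : S -> R) : Prop :=
  (forall F, F \in feas I ->
     vsum (fun s => cost I s - p s) (Fstar I)
     <= vsum (fun s => cost I s - p s) F)
  /\ (forall s, (lower I s <= (p s)%:E <= upper I s)%E).

Definition optimal (R : realType) (S : finType) (s0 : S) (I : instance R S)
    (p : S -> R) : Prop :=
  feasible I p /\ forall q, feasible I q -> span s0 I p <= span s0 I q.

Definition min_cost_oracle (R : realType) (S : finType) (I : instance R S)
    (O : (S -> R) -> {set S}) : Prop :=
  forall c', O c' \in feas I
    /\ forall F, F \in feas I -> vsum c' (O c') <= vsum c' F.

(** * Algorithms

    An algorithm is a finite program for a real RAM with oracle instructions:
    a while-language with natural-number variables and unbounded arrays of real
    numbers.  Variables and arrays are named by natural numbers.  The only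
    operations on reals are exact field operations and comparison, and the only
    constants are naturals, so one program serves all ground sets, all instances
    and all models of the reals. *)

Inductive nexp :=
  | NConst of nat
  | NVar of nat
  | NAdd of nexp & nexp
  | NSub of nexp & nexp
  | NMul of nexp & nexp.

Inductive rexp :=
  | RNat of nexp
  | RGet of nat & nexp
  | RAdd of rexp & rexp
  | RSub of rexp & rexp
  | RMul of rexp & rexp
  | RDiv of rexp & rexp.

Inductive bexp :=
  | BLeN of nexp & nexp
  | BLeR of rexp & rexp
  | BNot of bexp
  | BAnd of bexp & bexp.

(** [Query a b] sends the array [a] to the oracle as a cost function and stores
    the indicator vector of the answer in the array [b]. *)
Inductive cmd :=
  | Skip
  | NSet of nat & nexp
  | RSet of nat & nexp & rexp
  | Query of nat & nat
  | Seq of cmd & cmd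
  | If of bexp & cmd & cmd
  | While of bexp & cmd.

Record state (R : realType) := State {
  nvar : nat -> nat;
  rarr : nat -> nat -> R
}.

Definition upd (T : Type) (f : nat -> T) (x : nat) (v : T) : nat -> T :=
  fun y => if y == x then v else f y.

Fixpoint neval (R : realType) (st : state R) (e : nexp) : nat :=
  match e with
  | NConst k => k
  | NVar x => nvar st x
  | NAdd e1 e2 => neval st e1 + neval st e2
  | NSub e1 e2 => neval st e1 - neval st e2
  | NMul e1 e2 => neval st e1 * neval st e2
  end%N.

(** Division follows the convention [x / 0 = 0]. *)
Fixpoint reval (R : realType) (st : state R) (e : rexp) : R :=
  match e with
  | RNat k => (neval st k)%:R
  | RGet a i => rarr st a (neval st i)
  | RAdd e1 e2 => reval st e1 + reval st e2
  | RSub e1 e2 => reval st e1 - reval st e2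
  | RMul e1 e2 => reval st e1 * reval st e2
  | RDiv e1 e2 => reval st e1 / reval st e2
  end.

Fixpoint beval (R : realType) (st : state R) (b : bexp) : bool :=
  match b with
  | BLeN e1 e2 => (neval st e1 <= neval st e2)%N
  | BLeR e1 e2 => reval st e1 <= reval st e2
  | BNot b1 => ~~ beval st b1
  | BAnd b1 b2 => beval st b1 && beval st b2
  end.

Definition nupd (R : realType) (st : state R) (x v : nat) : state R :=
  State (upd (nvar st) x v) (rarr st).

Definition rupd (R : realType) (st : state R) (a i : nat) (v : R) : state R :=
  State (nvar st) (upd (rarr st) a (upd (rarr st a) i v)).

Definition aupd (R : realType) (st : state R) (a : nat) (f : nat -> R) : state R :=
  State (nvar st) (upd (rarr st) a f).

(** [exec ask P st k st']: started in [st], the program [P] terminates in [st']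
    after exactly [k] oracle calls.  The relation is deterministic. *)
Inductive exec (R : realType) (ask : (nat -> R) -> (nat -> R)) :
    cmd -> state R -> nat -> state R -> Prop :=
  | ExecSkip st : exec ask Skip st 0 st
  | ExecNSet x e st : exec ask (NSet x e) st 0 (nupd st x (neval st e))
  | ExecRSet a i e st :
      exec ask (RSet a i e) st 0 (rupd st a (neval st i) (reval st e))
  | ExecQuery a b st : exec ask (Query a b) st 1 (aupd st b (ask (rarr st a)))
  | ExecSeq P Q st k1 st1 k2 st2 :
      exec ask P st k1 st1 -> exec ask Q st1 k2 st2 ->
      exec ask (Seq P Q) st (k1 + k2)%N st2
  | ExecIfTrue b P Q st k st' :
      beval st b -> exec ask P st k st' -> exec ask (If b P Q) st k st'
  | ExecIfFalse b P Q st k st' :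
      ~~ beval st b -> exec ask Q st k st' -> exec ask (If b P Q) st k st'
  | ExecWhileFalse b P st : ~~ beval st b -> exec ask (While b P) st 0 st
  | ExecWhileTrue b P st k1 st1 k2 st2 :
      beval st b -> exec ask P st k1 st1 -> exec ask (While b P) st1 k2 st2 ->
      exec ask (While b P) st (k1 + k2)%N st2.

(** * Input and output

    A vector indexed by [S] is stored in an array following the enumeration
    [enum S]; the entries from [#|S|] on are [0]. *)

Definition encode (R : realType) (S : finType) (f : S -> R) : nat -> R :=
  fun i => nth 0 [seq f s | s <- enum S] i.

Definition decode (R : realType) (S : finType) (a : nat -> R) : S -> R :=
  fun s => a (index s (enum S)).
Arguments decode {R} S a _.

Definition indicator (R : realType) (S : finType) (X : {set S}) : S -> R :=
  fun s => (s \in X)%:R.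

Definition ask_oracle (R : realType) (S : finType) (O : (S -> R) -> {set S}) :
    (nat -> R) -> (nat -> R) :=
  fun a => encode (indicator R (O (decode S a))).

(** Variable 0 holds [#|S|].  A bound is stored as a finiteness flag and a value,
    the latter being 0 (by [fine]) for an infinite bound.  Arrays are listed in
    order from array 0; all other variables and array entries are 0.  The family
    [feas I] is not part of the input. *)
Definition input (R : realType) (S : finType) (I : instance R S) : state R :=
  State
    (fun x => if x == 0%N then #|S| else 0%N)
    (nth (fun=> 0)
       [:: encode (indicator R (Fstar I));
           encode (cost I);
           encode (weight I);
           encode (fun s => (lower I s \is a fin_num)%:R);
           encode (fun s => fine (lower I s));
           encode (fun s => (upper I s \is a fin_num)%:R);
           encode (fun s => fine (upper I s))]).

(** In a final state, [None] (variable 0 is 0) reports infeasibility; otherwise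
    the vector computed is in array 0. *)
Definition output (R : realType) (S : finType) (st : state R) : option (S -> R) :=
  if nvar st 0 == 0%N then None else Some (decode S (rarr st 0)).
Arguments output {R} S st.

Definition correct_output (R : realType) (S : finType) (s0 : S)
    (I : instance R S) (r : option (S -> R)) : Prop :=
  match r with
  | Some p => optimal s0 I p
  | None => ~ exists p, feasible I p
  end.

(* Main.v *)
Require Import Defs.
From mathcomp Require Import all_boot all_order all_algebra.
From mathcomp Require Import boolp reals constructive_ereal.
From mathcomp Require Import zify ring lra.

(** The algorithm is a cutting-plane method in the plane of pairs (hi, lo),
    where hi and lo bound the largest and the smallest value of w(s)p(s).

    For given hi and lo the deviation most favourable to F* within these
    bounds is explicit: on F* it is min(u, hi/w), elsewhere max(l, lo/w)
    ([dev]).  The instance is thus to minimize hi - lo over the pairs whose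
    deviation makes F* optimal and whose box constraints are consistent.  If F
    is a minimum-cost solution for the costs modified by such a deviation and
    F beats F*, linearizing at (hi, lo) gives a linear inequality
    a * hi - b * lo >= g that every attainable pair satisfies and the current
    one violates ([cut_tangent], [valid_cut]).  Its slopes a and b are sums of
    some of the 1/w(s), hence integers between 0 and the norm N of w.

    The oracle minimizes over all solutions, and the linear pieces of [dev]
    in use at a pair are the most binding ones there, so the cut obtained is
    the strongest one with its slopes ([dominant_cut]).  A pair satisfying the
    cuts found so far can then never produce the same slopes again, and there
    are at most (N + 1)^2 + 1 oracle calls.  Since n >= 1 and N >= 1 this is
    at most 5 N^2, well within the bound.

    Between two calls the program must find a pair of least gap hi - lo
    subject to the cuts.  As a and b are nonnegative, enlarging the gap by
    lowering lo never invalidates a cut.  A new cut therefore only requires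
    raising the gap to the values forced by the cut alone or by the cut and
    an old one (a Fourier-Motzkin elimination, [pair_gap_le]), then sliding
    the pair, at constant gap, onto the boundary of the new cut
    ([holds_clamp], [solves_rcons]).  The only cut that no pair can satisfy
    has slopes 0, and it appears exactly when the instance is infeasible. *)

Set Implicit Arguments.
Unset Strict Implicit.
Unset Printing Implicit Defensive.

Import Order.TTheory GRing.Theory Num.Theory.
Local Open Scope ring_scope.

(** * Cuts of the (max, min) plane *)

Section Cuts.
Variable R : realType.
Implicit Types (c : R * R * R) (hi lo x D : R).

(** The triple [(a, b, g)] encodes the half-plane [a * hi - b * lo >= g]. *)
Definition holds c hi lo : bool := c.2 <= c.1.1 * hi - c.1.2 * lo.

Definition nonneg c : bool := (0 <= c.1.1) && (0 <= c.1.2).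

(** Moving [(hi, lo)] along a line of constant gap [hi - lo] changes the left
    side of the cut at this rate. *)
Definition tilt c : R := c.1.1 - c.1.2.

(** The gap [hi - lo] at the intersection of the boundaries of [c] and [c']. *)
Definition pair_gap c c' : R :=
  (c'.2 * tilt c - c.2 * tilt c') / (c.1.1 * c'.1.2 - c'.1.1 * c.1.2).

Lemma holds_widen c x D D' :
  nonneg c -> D <= D' -> holds c x (x - D) -> holds c x (x - D').
Proof.
case: c => -[a b] g; rewrite /holds /nonneg /= => /andP[a0 b0] DD' h.
by apply: le_trans h _; rewrite lerD2l lerN2 ler_wpM2l // lerD2l lerN2.
Qed.

Lemma pair_denominator c c' :
  c.1.1 * c'.1.2 - c'.1.1 * c.1.2 = c'.1.2 * tilt c - c.1.2 * tilt c'.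
Proof. by rewrite /tilt; ring. Qed.

Lemma pair_gap_sym c c' : pair_gap c c' = pair_gap c' c.
Proof.
rewrite /pair_gap -[in RHS]opprB -[X in _ = - _ / X]opprB invrN mulrNN.
by congr (_ / _); ring.
Qed.

Lemma pair_denominator_gt0 c c' : nonneg c -> nonneg c' ->
  0 < tilt c -> tilt c' < 0 -> 0 < c.1.1 * c'.1.2 - c'.1.1 * c.1.2.
Proof.
case: c => -[a b] g; case: c' => -[a' b'] g'; rewrite /nonneg /tilt /=.
move=> /andP[a0 b0] /andP[a'0 b'0] ab a'b'; nra.
Qed.

(** Of two cuts tilted in opposite directions, the combination with weights
    [- tilt c'] and [tilt c] bounds a multiple of the gap alone from below. *)
Lemma pair_gap_le c c' hi lo : nonneg c -> nonneg c' ->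
  tilt c * tilt c' < 0 -> holds c hi lo -> holds c' hi lo ->
  pair_gap c c' <= hi - lo.
Proof.
wlog tc : c c' / 0 < tilt c.
  move=> W nc nc' opp hc hc'; have [tc|tc] := ltP 0 (tilt c); first exact: W.
  by rewrite pair_gap_sym; apply: W => //; nra.
move=> nc nc' opp hc hc'; have tc' : tilt c' < 0 by rewrite -(pmulr_rlt0 _ tc).
rewrite ler_pdivrMr ?pair_denominator_gt0 // pair_denominator.
move: tc tc' hc hc'; rewrite /holds /tilt; nra.
Qed.

(** Moving along the line of constant gap onto the boundary of a violated cut
    [c] can only hurt the cuts tilted the other way, and these tolerate it as
    soon as the gap reaches the one that they force together with [c]. *)
Lemma holds_clamp c c' x x' D : nonneg c -> nonneg c' -> tilt c != 0 ->
  (tilt c * tilt c' < 0 -> pair_gap c c' <= D) ->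
  x' * tilt c = c.2 - c.1.2 * D ->
  ~~ holds c x (x - D) -> holds c' x (x - D) -> holds c' x' (x' - D).
Proof.
move=> nc nc' tc0 gap x'E hc hc'.
have holdsE d z : holds d z (z - D) = (d.2 <= tilt d * z + d.1.2 * D).
  by rewrite /holds /tilt; congr (_ <= _); ring.
rewrite holdsE -ltNge in hc; rewrite holdsE in hc'; rewrite holdsE.
have tx : 0 < tilt c * (x' - x).
  by rewrite mulrBr [_ * x']mulrC x'E subr_gt0 ltrBrDr.
have [opp|same] := ltP (tilt c * tilt c') 0; last first.
  have : 0 <= tilt c' * (x' - x).
    have tc2 : 0 < tilt c ^+ 2 by rewrite exprn_even_gt0.
    rewrite -(pmulr_rge0 _ tc2).
    have -> : tilt c ^+ 2 * (tilt c' * (x' - x)) =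
              (tilt c * tilt c') * (tilt c * (x' - x)) by ring.
    by rewrite mulr_ge0 // ltW.
  by rewrite mulrBr; lra.
have {gap} := gap opp; have [tc|tc] := ltP 0 (tilt c).
  have tc' : tilt c' < 0 by nra.
  rewrite ler_pdivrMr ?pair_denominator_gt0 // pair_denominator => gap.
  rewrite -(ler_pM2r tc); nra.
have tc' : 0 < tilt c' by nra.
have {}tc : tilt c < 0 by rewrite lt_neqAle tc0.
rewrite pair_gap_sym ler_pdivrMr ?pair_denominator_gt0 // pair_denominator => gap.
rewrite -(ler_nM2r tc); nra.
Qed.

Lemma flat_slope_gt0 c :
  tilt c = 0 -> 0 < c.1.1 + c.1.2 -> c.1.1 = c.1.2 /\ 0 < c.1.1.
Proof.
move=> /eqP; rewrite subr_eq0 => /eqP ab c0.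
by split=> //; move: c0; rewrite -ab; lra.
Qed.

Lemma holds_flat c hi lo : tilt c = 0 -> 0 < c.1.1 + c.1.2 ->
  holds c hi lo = (c.2 / c.1.1 <= hi - lo).
Proof.
move=> tc c0; have [ab a0] := flat_slope_gt0 tc c0.
by rewrite /holds -ab -mulrBr mulrC ler_pdivrMr.
Qed.

Lemma holds_on_boundary c x D :
  x * tilt c = c.2 - c.1.2 * D -> holds c x (x - D).
Proof. by rewrite /holds /tilt => xE; nra. Qed.

Section Relaxation.
Variable T : R -> R -> Prop.

Definition valid c : Prop := forall hi lo, T hi lo -> holds c hi lo.

(** These conditions make [(x, x - D)] a pair of least gap in [T] as soon as it
    belongs to [T]. *)
Definition solves (cs : seq (R * R * R)) x D : Prop :=
  [/\ forall c, c \in cs -> [/\ nonneg c, valid c & holds c x (x - D)],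
      0 <= D & forall hi lo, T hi lo -> D <= hi - lo].

(** A cut of tilt [0] constrains the gap only, so it holds once the gap has
    been raised; any other cut can be reached by sliding the pair. *)
Lemma solves_rcons cs c x D D' :
  solves cs x D -> nonneg c -> valid c -> 0 < c.1.1 + c.1.2 -> D <= D' ->
  (forall hi lo, T hi lo -> D' <= hi - lo) ->
  (forall c', c' \in cs -> tilt c * tilt c' < 0 -> pair_gap c c' <= D') ->
  (tilt c = 0 -> c.2 / c.1.1 <= D') ->
  solves (rcons cs c)
    (if holds c x (x - D') then x else (c.2 - c.1.2 * D') / tilt c) D'.
Proof.
case=> csP D0 Dle nc vc c0 DD' D'le gaps flat.
split; [|exact: le_trans DD'|by []].
move=> c'; rewrite mem_rcons inE => /predU1P[->|c'cs].
  split=> //; have [//|hc] := boolP (holds c x (x - D')).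
  have [tc|tc] := eqVneq (tilt c) 0; last by rewrite holds_on_boundary ?divfK.
  by rewrite holds_flat // subKr flat in hc.
have [nc' vc' hc'] := csP c' c'cs.
have {}hc' := holds_widen nc' DD' hc'; split=> //.
have [//|hc] := boolP (holds c x (x - D')).
have [tc|tc] := eqVneq (tilt c) 0.
  by rewrite holds_flat // subKr flat in hc.
by apply: (holds_clamp nc nc' tc _ _ hc hc'); [exact: gaps|rewrite divfK].
Qed.

End Relaxation.
End Cuts.

(** * Cuts given by minimum-cost solutions *)

Section Instance.
Variables (R : realType) (S : finType) (I : instance R S).
Implicit Types (hi lo x D : R) (p q : S -> R) (F : {set S}) (s : S).
Hypothesis wfI : wf_instance I.
Let w := weight I.
Let ind F s : R := indicator R F s.

Definition capped hi lo s : bool :=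
  if s \in Fstar I
  then (upper I s \is a fin_num) && (w s * fine (upper I s) <= hi)
  else (lower I s \is a fin_num) && (lo <= w s * fine (lower I s)).

Definition dev hi lo s : R :=
  if s \in Fstar I then if capped hi lo s then fine (upper I s) else hi / w s
  else if capped hi lo s then fine (lower I s) else lo / w s.

(** The slope of the piece of [dev] in use, as a function of [hi] or [lo]. *)
Definition rate hi lo s : R := if capped hi lo s then 0 else (w s)^-1.

Definition slope_hi hi lo F : R :=
  \sum_s rate hi lo s * (ind (Fstar I) s * (1 - ind F s)).

Definition slope_lo hi lo F : R :=
  \sum_s rate hi lo s * ((1 - ind (Fstar I) s) * ind F s).

(** By how much [F] beats [Fstar I] for the costs modified by [p]. *)
Definition viol p F : R :=
  \sum_s (cost I s - p s) * (ind (Fstar I) s - ind F s).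

Definition cut hi lo F : R * R * R :=
  (slope_hi hi lo F, slope_lo hi lo F,
   viol (dev hi lo) F + slope_hi hi lo F * hi - slope_lo hi lo F * lo).

Lemma weight_gt0 s : 0 < w s.
Proof. by case: wfI. Qed.

Lemma violE p F : viol p F =
  vsum (fun s => cost I s - p s) (Fstar I) - vsum (fun s => cost I s - p s) F.
Proof.
rewrite /viol /vsum [X in X - _]big_mkcond [X in _ - X]big_mkcond /= -sumrB.
apply: eq_bigr => s _; rewrite /ind /indicator.
by case: ifP; case: ifP; rewrite ?subrr ?subr0 ?sub0r ?mulr0 ?mulr1 ?mulrN1.
Qed.

(** Only the sides of the bounds that prevent [q] from favouring [Fstar I]
    more; they hold for feasible deviations and for [dev] alike, even where
    [dev] is infeasible, so that [cut_tangent] serves both. *)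
Definition reach hi lo q : Prop :=
  forall s, if s \in Fstar I then q s <= hi / w s /\ ((q s)%:E <= upper I s)%E
            else lo / w s <= q s /\ (lower I s <= (q s)%:E)%E.

Lemma reach_feasible hi lo q : feasible I q ->
  (forall s, lo <= w s * q s <= hi) -> reach hi lo q.
Proof.
move=> [_ qI] qw s; have /andP[l u] := qI s; have /andP[lo_q q_hi] := qw s.
by case: ifP => _; split=> //; rewrite ?ler_pdivlMr ?ler_pdivrMr ?weight_gt0 // mulrC.
Qed.

Lemma reach_dev hi lo : reach hi lo (dev hi lo).
Proof.
move=> s; have w0 := weight_gt0 s; have [_ _ _ /(_ s)[lN uN _]] := wfI.
rewrite /dev /capped; case: ifP => sF; rewrite sF.
  case: (upper I s) uN => [u||] //= _; rewrite ?lee_fin ?leey ?lexx //.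
  rewrite [w s * _]mulrC; have [wu|wu] := leP (u * w s) hi;
  by split=> //; rewrite ?ler_pdivlMr ?ler_pdivrMr // ltW.
case: (lower I s) lN => [l||] //= _; rewrite ?lee_fin ?leNye ?lexx //.
rewrite [w s * _]mulrC; have [wl|wl] := leP lo (l * w s);
by split=> //; rewrite ?ler_pdivlMr ?ler_pdivrMr // ltW.
Qed.

(** In each coordinate [dev] is a concave function of [hi] on [Fstar I] and a
    convex function of [lo] elsewhere, so it lies on the right side of the
    tangent taken at another pair. *)
Lemma cut_tangent hi lo hi' lo' q F : reach hi' lo' q ->
  (cut hi lo F).2 <=
  viol q F + slope_hi hi lo F * hi' - slope_lo hi lo F * lo'.
Proof.
move=> rq; rewrite /= -subr_ge0.
have -> : viol q F + slope_hi hi lo F * hi' - slope_lo hi lo F * lo' -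
  (viol (dev hi lo) F + slope_hi hi lo F * hi - slope_lo hi lo F * lo) =
  (viol q F - viol (dev hi lo) F) + slope_hi hi lo F * (hi' - hi)
  + slope_lo hi lo F * (lo - lo') by ring.
rewrite /viol /slope_hi /slope_lo -sumrB !mulr_suml -!big_split /=.
apply: sumr_ge0 => s _; have w0 := weight_gt0 s; have := rq s.
have [_ _ _ /(_ s)[lN uN _]] := wfI.
rewrite /rate /dev /capped /ind /indicator.
have [sFs|sFs] := ifP; rewrite ?sFs /= => -[].
  have [sF|sF] := boolP (s \in F); first by rewrite !(subrr, mulr0, mul0r, addr0).
  rewrite !(subr0, mulr1, subrr, mul0r, mulr0, addr0) => qhi qu.
  move: qu; case: ifP => [/andP[ufin _]|_].
    rewrite -(fineK ufin) lee_fin; lra.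
  move=> _; have -> : (w s)^-1 * (hi' - hi) = hi' / w s - hi / w s by ring.
  lra.
have [sF|sF] := boolP (s \in F); last first.
  by rewrite !(subr0, subrr, mulr0, mul0r, addr0).
rewrite !(sub0r, subr0, mulr1, mul0r, mulr0, addr0, mulrN1) => qlo ql.
move: ql; case: ifP => [/andP[lfin _]|_].
  rewrite -(fineK lfin) lee_fin; lra.
move=> _; have -> : (w s)^-1 * (lo - lo') = lo / w s - lo' / w s by ring.
lra.
Qed.

Definition attainable hi lo : Prop :=
  exists2 q, feasible I q & forall s, lo <= w s * q s <= hi.

Lemma valid_cut hi lo F : F \in feas I -> valid attainable (cut hi lo F).
Proof.
move=> FI hi' lo' [q qf qw]; have := cut_tangent hi lo F (reach_feasible qf qw).
have : viol q F <= 0 by rewrite violE subr_le0; apply: qf.1.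
by rewrite /holds /=; lra.
Qed.

(** No solution yields, at any pair, a stronger cut with the slopes of [c]. *)
Definition dominant (c : R * R * R) : Prop :=
  forall hi lo F, F \in feas I ->
  (cut hi lo F).1 = c.1 -> (cut hi lo F).2 <= c.2.

(** By [cut_tangent] with [dev hi lo] itself as the vector within reach: a cut
    with the same slopes, whatever pair it was computed at, can exceed this one
    only if its solution beats [Fstar I] at [(hi, lo)] by more than [F]. *)
Lemma dominant_cut hi lo F :
  (forall F', F' \in feas I -> viol (dev hi lo) F' <= viol (dev hi lo) F) ->
  dominant (cut hi lo F).
Proof.
move=> Fmax hi' lo' F' F'I [eh el].
apply: le_trans (cut_tangent hi' lo' F' (reach_dev hi lo)) _.
by rewrite eh el /= lerD2r lerD2r Fmax.
Qed.

Lemma holds_cut hi lo F : holds (cut hi lo F) hi lo = (viol (dev hi lo) F <= 0).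
Proof. by rewrite /holds /= -subr_ge0 -[RHS]subr_ge0; congr (_ <= _); ring. Qed.

Lemma rate_ge0 hi lo s : 0 <= rate hi lo s.
Proof. by rewrite /rate; case: ifP => // _; rewrite invr_ge0 ltW ?weight_gt0. Qed.

Lemma rate_le hi lo s : rate hi lo s <= (w s)^-1.
Proof. by rewrite /rate; case: ifP => // _; rewrite invr_ge0 ltW ?weight_gt0. Qed.

Lemma invw_nat s : (w s)^-1 \is a Num.nat.
Proof.
by rewrite natrEint; apply/andP; split; [case: wfI|rewrite invr_ge0 ltW ?weight_gt0].
Qed.

Lemma rate_nat hi lo s : rate hi lo s \is a Num.nat.
Proof. by rewrite /rate; case: ifP => _; rewrite ?invw_nat ?rpred0. Qed.

Definition slope_grid (N : nat) : seq (R * R) :=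
  [seq (i%:R, j%:R) | i <- iota 0 N.+1, j <- iota 0 N.+1].

Lemma wnorm_nat : wnorm I \is a Num.nat.
Proof. by apply: rpred_sum => s _; apply: invw_nat. Qed.

(** Each slope is a sum of some of the positive integers
    [(weight I s)^-1], whose total is [wnorm I]. *)
Lemma grid_slopes N hi lo F :
  wnorm I = N%:R -> (cut hi lo F).1 \in slope_grid N.
Proof.
move=> WN; have key (e : S -> R) : (forall s, e s = 0 \/ e s = 1) ->
    exists2 i, i \in iota 0 N.+1 & \sum_s rate hi lo s * e s = i%:R.
  move=> e01; have /natrP[i iE] : \sum_s rate hi lo s * e s \is a Num.nat.
    apply: rpred_sum => s _; apply: rpredM; first exact: rate_nat.
    by case: (e01 s) => ->; rewrite ?rpred0 ?rpred1.
  exists i => //; rewrite mem_iota add0n ltnS /= -(ler_nat R) -iE -WN.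
  apply: ler_sum => s _; apply: le_trans (rate_le hi lo s).
  by case: (e01 s) => ->; rewrite ?mulr0 ?mulr1 ?rate_ge0.
rewrite /= /slope_hi /slope_lo.
have [|i iN ->] := key (fun s => ind (Fstar I) s * (1 - ind F s)).
  move=> s; rewrite /ind /indicator.
  by case: (s \in F); case: (s \in Fstar I);
     rewrite ?(subrr, subr0, mulr0, mul0r, mulr1); auto.
have [|j jN ->] := key (fun s => (1 - ind (Fstar I) s) * ind F s).
  move=> s; rewrite /ind /indicator.
  by case: (s \in F); case: (s \in Fstar I);
     rewrite ?(subrr, subr0, mulr0, mul0r, mulr1); auto.
exact: allpairs_f.
Qed.

Lemma nonneg_cut hi lo F : nonneg (cut hi lo F).
Proof.
have /natrP[N /grid_slopes WN] := wnorm_nat.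
have /allpairsP[[i j] /= [_ _ [eh el]]] := WN hi lo F.
by rewrite /nonneg /= eh el !ler0n.
Qed.

Lemma span_le (s0 : S) p D lo : 
  (forall s, lo <= w s * p s <= lo + D) -> Defs.span s0 I p <= D.
Proof.
move=> pw; have -> : D = lo + D - lo by ring.
by rewrite /span lerB //; [apply: bigmax_le => [|s _]|apply: le_bigmin => [|s _]];
   case/andP: (pw s0) => // ??; case/andP: (pw s).
Qed.

Lemma attainable_span (s0 : S) p : feasible I p ->
  exists hi lo, attainable hi lo /\ Defs.span s0 I p = hi - lo.
Proof.
move=> fp; eexists; eexists; split; last by [].
by exists p => // s; rewrite bigmin_le le_bigmax.
Qed.

Lemma optimal_dev (s0 : S) x D :
  0 <= D -> (forall hi lo, attainable hi lo -> D <= hi - lo) ->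
  (forall s, lower I s \is a fin_num -> w s * fine (lower I s) <= x) ->
  (forall s, upper I s \is a fin_num -> x - D <= w s * fine (upper I s)) ->
  (forall F, F \in feas I -> viol (dev x (x - D)) F <= 0) ->
  optimal s0 I (dev x (x - D)).
Proof.
move=> D0 Dle lx ux vF; split; last first.
  move=> q fq; have [hi [lo [at_ ->]]] := attainable_span s0 fq.
  apply: le_trans (Dle _ _ at_); apply: (@span_le _ _ _ (x - D)) => s.
  have w0 := weight_gt0 s; rewrite subrK /dev /capped.
  case: ifP => sF; rewrite sF.
    case: ifP => [/andP[uf ->]|_]; first by rewrite ux.
    by rewrite mulrC divfK ?gt_eqF // lexx andbT gerBl.
  case: ifP => [/andP[lf ->]|_]; first by rewrite lx.
  by rewrite mulrC divfK ?gt_eqF // lexx /= gerBl.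
split=> [F FI|s]; first by rewrite -subr_le0 -violE vF.
have w0 := weight_gt0 s; have [_ _ _ /(_ s)[lN uN lu]] := wfI.
have := reach_dev x (x - D) s; rewrite /dev /capped.
have lo_lower y : w s * fine (lower I s) <= y \/ lower I s = -oo%E ->
    (lower I s <= (y / w s)%:E)%E.
  case: (lower I s) lN => [l||] //= _; rewrite ?leNye // lee_fin.
  by case=> // h; rewrite ler_pdivlMr // mulrC.
have up_upper y : y <= w s * fine (upper I s) \/ upper I s = +oo%E ->
    ((y / w s)%:E <= upper I s)%E.
  case: (upper I s) uN => [u||] //= _; rewrite ?leey // lee_fin.
  by case=> // h; rewrite ler_pdivrMr // mulrC.
case: ifP => sF; rewrite sF => -[_ b]; rewrite b ?andbT /=.
  case: ifP => [/andP[uf _]|_]; first by rewrite fineK.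
  apply: lo_lower; case: (lower I s) lN (lx s) => [l||] //= _ h; [left|right] => //.
  exact: h.
case: ifP => [/andP[lf _]|_]; first by rewrite fineK.
apply: up_upper; case: (upper I s) uN (ux s) => [u||] //= _ h; [left|right] => //.
exact: h.
Qed.

End Instance.

(** * Reasoning about programs *)

(** Total correctness with an exact number of oracle calls. *)
Definition runs (R : realType) (ask : (nat -> R) -> nat -> R) (P : cmd)
    (st : state R) (k : nat) (Q : state R -> Prop) : Prop :=
  exists2 st', exec ask P st k st' & Q st'.

Fixpoint nwrites (P : cmd) : seq nat :=
  match P with
  | NSet x _ => [:: x]
  | Seq P1 P2 | If _ P1 P2 => nwrites P1 ++ nwrites P2
  | While _ P1 => nwrites P1
  | _ => [::]
  end.

Fixpoint awrites (P : cmd) : seq nat :=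
  match P with
  | RSet a _ _ => [:: a]
  | Query _ b => [:: b]
  | Seq P1 P2 | If _ P1 P2 => awrites P1 ++ awrites P2
  | While _ P1 => awrites P1
  | _ => [::]
  end.

(** Specifications then only mention what a program changes. *)
Definition framed (R : realType) (P : cmd) (st st' : state R) : Prop :=
  (forall x, x \notin nwrites P -> nvar st' x = nvar st x) /\
  (forall a, a \notin awrites P -> rarr st' a = rarr st a).

Definition For (i v : nat) (body : cmd) : cmd :=
  Seq (NSet i (NConst 0))
      (While (BNot (BLeN (NVar v) (NVar i)))
             (Seq body (NSet i (NAdd (NVar i) (NConst 1))))).

Section ProgramLogic.
Variables (R : realType) (ask : (nat -> R) -> nat -> R).
Implicit Types (st : state R) (P : cmd) (Q : state R -> Prop).

Lemma exec_framed P st k st' : exec ask P st k st' -> framed P st st'.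
Proof.
elim=> {P st k st'} //=.
- move=> x e st; split=> // y; rewrite inE => /negPf yx.
  by rewrite /= /upd yx.
- move=> a i e st; split=> // b; rewrite inE => /negPf ba.
  by rewrite /= /upd ba.
- move=> a b st; split=> // c; rewrite inE => /negPf cb.
  by rewrite /= /upd cb.
- move=> P1 P2 st k1 st1 k2 st2 _ [n1 a1] _ [n2 a2].
  by split=> x; rewrite mem_cat => /norP[h1 h2]; [rewrite n2 ?n1|rewrite a2 ?a1].
- move=> b P1 P2 st k st' _ _ [n1 a1].
  by split=> x; rewrite mem_cat => /norP[h1 h2]; [rewrite n1|rewrite a1].
- move=> b P1 P2 st k st' _ _ [n1 a1].
  by split=> x; rewrite mem_cat => /norP[h1 h2]; [rewrite n1|rewrite a1].
- move=> b P1 st k1 st1 k2 st2 _ _ [n1 a1] _ [n2 a2].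
  by split=> x h; [rewrite n2 ?n1|rewrite a2 ?a1].
Qed.

Lemma runs_framed P st k Q : runs ask P st k Q ->
  runs ask P st k (fun st' => Q st' /\ framed P st st').
Proof. by case=> st' e q; exists st' => //; split=> //; apply: exec_framed e. Qed.

Lemma runs_weaken P st k Q Q' : (forall st', Q st' -> Q' st') ->
  runs ask P st k Q -> runs ask P st k Q'.
Proof. by move=> QQ' [st' e q]; exists st' => //; apply: QQ'. Qed.

Lemma runs_Seq P P' st k1 k2 Q :
  runs ask P st k1 (fun st1 => runs ask P' st1 k2 Q) ->
  runs ask (Seq P P') st (k1 + k2) Q.
Proof. by case=> st1 e1 [st2 e2 q]; exists st2 => //; apply: ExecSeq e1 e2. Qed.

(** Most sequences start with a part that makes no call; stating the count as
    [k] instead of [0 + k] lets the rule apply to any goal. *)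
Lemma runs_Seq0 P P' st k Q :
  runs ask P st 0 (fun st1 => runs ask P' st1 k Q) ->
  runs ask (Seq P P') st k Q.
Proof. exact: runs_Seq. Qed.

Lemma runs_Skip st Q : Q st -> runs ask Skip st 0 Q.
Proof. by exists st => //; constructor. Qed.

Lemma runs_NSet x e st Q :
  Q (nupd st x (neval st e)) -> runs ask (NSet x e) st 0 Q.
Proof. by move=> q; eexists; [constructor|]. Qed.

Lemma runs_RSet a i e st Q :
  Q (rupd st a (neval st i) (reval st e)) -> runs ask (RSet a i e) st 0 Q.
Proof. by move=> q; eexists; [constructor|]. Qed.

Lemma runs_Query a b st Q :
  Q (aupd st b (ask (rarr st a))) -> runs ask (Query a b) st 1 Q.
Proof. by move=> q; eexists; [constructor|]. Qed.

Lemma runs_If b P P' st k Q :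
  (beval st b -> runs ask P st k Q) -> (~~ beval st b -> runs ask P' st k Q) ->
  runs ask (If b P P') st k Q.
Proof.
move=> hP hP'; have [bt|bf] := boolP (beval st b).
  by have [st' e q] := hP bt; exists st' => //; apply: ExecIfTrue.
by have [st' e q] := hP' bf; exists st' => //; apply: ExecIfFalse.
Qed.

(** The step may assume that the state agrees with the initial one outside the
    variables written by the loop. *)
Lemma runs_For i v body (Inv : nat -> state R -> Prop) st Q :
  i != v -> i \notin nwrites body -> v \notin nwrites body ->
  Inv 0%N (nupd st i 0) ->
  (forall k st1, (k < nvar st v)%N -> framed (For i v body) st st1 ->
     nvar st1 i = k -> Inv k st1 ->
     runs ask body st1 0 (fun st2 => Inv k.+1 (nupd st2 i k.+1))) ->
  (forall st', Inv (nvar st v) st' -> framed (For i v body) st st' -> Q st') ->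
  runs ask (For i v body) st 0 Q.
Proof.
move=> iv ib vb I0 step IQ.
apply: (@runs_weaken _ _ _ (fun st' =>
  Inv (nvar st v) st' /\ framed (For i v body) st st')).
  by move=> st' []; apply: IQ.
apply/runs_framed/runs_Seq0/runs_NSet => /=.
have fr0 : framed (For i v body) st (nupd st i 0).
  split=> x //=; rewrite !inE => /norP[/negPf xi _].
  by rewrite /upd xi.
suff loop n k st1 : (nvar st v - k)%N = n -> (k <= nvar st v)%N -> Inv k st1 ->
    nvar st1 i = k -> framed (For i v body) st st1 ->
    runs ask (While (BNot (BLeN (NVar v) (NVar i)))
                    (Seq body (NSet i (NAdd (NVar i) (NConst 1))))) st1 0
         (Inv (nvar st v)).
  by apply: (loop _ 0%N _ erefl) => //=; rewrite /upd eqxx.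
elim: n k st1 => [|n IH] k st1 nE kn Ik ik fr.
  have {nE kn} kE : k = nvar st v.
    by apply/eqP; rewrite eqn_leq kn -subn_eq0 nE.
  exists st1; last by rewrite -kE.
  apply: ExecWhileFalse; rewrite /= negbK ik kE fr.1 //.
  by rewrite /= !inE negb_or eq_sym iv mem_cat inE negb_or vb eq_sym iv.
have vE : nvar st1 v = nvar st v.
  by rewrite fr.1 // /= !inE negb_or eq_sym iv mem_cat inE negb_or vb eq_sym iv.
have kv : (k < nvar st v)%N by rewrite -subn_gt0 nE.
have [st2 e2 I2] := step k st1 kv fr ik Ik.
have f2 := exec_framed e2.
have i2 : nvar st2 i = k by rewrite f2.1.
have fr' : framed (For i v body) st (nupd st2 i k.+1).
  have fs : framed (For i v body) st1 (nupd st2 i k.+1).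
    split=> x; rewrite /= ?inE ?mem_cat ?inE.
      by case/norP=> /negPf xi /norP[xb _]; rewrite /upd xi f2.1.
    by case/norP=> xb _; rewrite f2.2.
  by split=> x h; [rewrite fs.1 ?fr.1|rewrite fs.2 ?fr.2].
have nE' : (nvar st v - k.+1)%N = n by rewrite subnS nE.
have i3 : nvar (nupd st2 i k.+1) i = k.+1 by rewrite /= /upd eqxx.
have [st3 e3 I3] := IH _ _ nE' kv I2 i3 fr'.
exists st3 => //; apply: (@ExecWhileTrue _ _ _ _ _ 0 (nupd st2 i k.+1) 0) => //.
  by rewrite /= -ltnNge ik vE.
apply: (@ExecSeq _ _ _ _ _ 0 st2 0) => //.
have -> : k.+1 = neval st2 (NAdd (NVar i) (NConst 1)) by rewrite /= i2 addn1.
exact: ExecNSet.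
Qed.

End ProgramLogic.

(** * The program *)

(** Number variables: the size of the ground set, the number of stored cuts, two
    loop counters, and a flag telling whether the search goes on. *)
Local Notation vS := 0%N (only parsing).
Local Notation vM := 1%N (only parsing).
Local Notation vJ := 2%N (only parsing).
Local Notation vI := 3%N (only parsing).
Local Notation vRun := 4%N (only parsing).

(** Arrays [0] to [6] hold the input, in the order fixed by [input]; [aF] finally
    receives the result.  Then come the cost vector of a query, the answer, the
    deviation with its rates, and the stored cuts. *)
Local Notation aF := 0%N (only parsing).
Local Notation aC := 1%N (only parsing).
Local Notation aW := 2%N (only parsing).
Local Notation aLfin := 3%N (only parsing).
Local Notation aL := 4%N (only parsing).
Local Notation aUfin := 5%N (only parsing).
Local Notation aU := 6%N (only parsing).
Local Notation aQ := 7%N (only parsing).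
Local Notation aAns := 8%N (only parsing).
Local Notation aP := 9%N (only parsing).
Local Notation aRate := 10%N (only parsing).
Local Notation aHi := 11%N (only parsing).
Local Notation aLo := 12%N (only parsing).
Local Notation aRhs := 13%N (only parsing).
(** Scalars are kept at index [0] of an array of their own: the gap, the first
    coordinate of the current pair, and a cut under construction. *)
Local Notation sD := 14%N (only parsing).
Local Notation sX := 15%N (only parsing).
Local Notation sHi := 16%N (only parsing).
Local Notation sLo := 17%N (only parsing).
Local Notation sRhs := 18%N (only parsing).

Definition get (a : nat) : rexp := RGet a (NConst 0).
Definition set (a : nat) (e : rexp) : cmd := RSet a (NConst 0) e.
Definition num (k : nat) : rexp := RNat (NConst k).
Local Notation "P ;; P'" := (Seq P P') (at level 61, right associativity).

Definition raise_gap (e : rexp) : cmd := If (BLeR e (get sD)) Skip (set sD e).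

(** The numerator and the denominator of [pair_gap] both change sign when the
    two cuts are exchanged, so one formula covers both orders of the tilts. *)
Definition add_cut : cmd :=
  let aj := RGet aHi (NVar vJ) in
  let bj := RGet aLo (NVar vJ) in
  let tilt := RSub (get sHi) (get sLo) in
  let tiltj := RSub aj bj in
  RSet aHi (NVar vM) (get sHi);;
  RSet aLo (NVar vM) (get sLo);;
  RSet aRhs (NVar vM) (get sRhs);;
  If (BAnd (BLeR tilt (num 0)) (BLeR (num 0) tilt))
     (raise_gap (RDiv (get sRhs) (get sHi))) Skip;;
  For vJ vM
    (If (BLeR (num 0) (RMul tilt tiltj)) Skip
       (raise_gap
          (RDiv (RSub (RMul (RGet aRhs (NVar vJ)) tilt) (RMul (get sRhs) tiltj))
                (RSub (RMul (get sHi) bj) (RMul aj (get sLo))))));;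
  If (BLeR (get sRhs)
           (RSub (RMul (get sHi) (get sX))
                 (RMul (get sLo) (RSub (get sX) (get sD)))))
     Skip
     (set sX (RDiv (RSub (get sRhs) (RMul (get sLo) (get sD))) tilt));;
  NSet vM (NAdd (NVar vM) (NConst 1)).

Definition add_bounds : cmd :=
  let at_i a := RGet a (NVar vI) in
  For vI vS
    (If (BLeR (num 1) (at_i aLfin))
        (set sHi (num 1);; set sLo (num 0);;
         set sRhs (RMul (at_i aW) (at_i aL));; add_cut)
        Skip;;
     If (BLeR (num 1) (at_i aUfin))
        (set sHi (num 0);; set sLo (num 1);;
         set sRhs (RSub (num 0) (RMul (at_i aW) (at_i aU)));; add_cut)
        Skip).

Definition build_deviation : cmd :=
  let at_i a := RGet a (NVar vI) in
  let put a e := RSet a (NVar vI) e in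
  let at_bound a := put aP (at_i a);; put aRate (num 0) in
  let at_end e := put aP (RDiv e (at_i aW));; put aRate (RDiv (num 1) (at_i aW)) in
  let lo := RSub (get sX) (get sD) in
  For vI vS
    (If (BLeR (num 1) (at_i aF))
        (If (BAnd (BLeR (num 1) (at_i aUfin))
                  (BLeR (RMul (at_i aW) (at_i aU)) (get sX)))
            (at_bound aU) (at_end (get sX)))
        (If (BAnd (BLeR (num 1) (at_i aLfin))
                  (BLeR lo (RMul (at_i aW) (at_i aL))))
            (at_bound aL) (at_end lo));;
     put aQ (RSub (at_i aC) (at_i aP))).

(** Applied to indicators, the products select the difference of the two
    solutions without any test. *)
Definition measure_answer : cmd :=
  let at_i a := RGet a (NVar vI) in
  let increase a e := set a (RAdd (get a) e) in
  set sHi (num 0);; set sLo (num 0);; set sRhs (num 0);;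
  For vI vS
    (increase sHi
       (RMul (at_i aRate) (RMul (at_i aF) (RSub (num 1) (at_i aAns))));;
     increase sLo
       (RMul (at_i aRate) (RMul (RSub (num 1) (at_i aF)) (at_i aAns)));;
     increase sRhs (RMul (at_i aQ) (RSub (at_i aF) (at_i aAns)))).

(** If even the best answer does not beat [Fstar I], the current pair is optimal;
    a violated cut of slopes [0] excludes every pair. *)
Definition round : cmd :=
  build_deviation;;
  Query aQ aAns;;
  measure_answer;;
  If (BLeR (get sRhs) (num 0))
     (NSet vRun (NConst 0))
     (If (BLeR (RAdd (get sHi) (get sLo)) (num 0))
         (NSet vRun (NConst 0);; NSet vS (NConst 0))
         (set sRhs (RSub (RAdd (get sRhs) (RMul (get sHi) (get sX)))
                         (RMul (get sLo) (RSub (get sX) (get sD))));;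
          add_cut)).

Definition rounds : cmd := While (BLeN (NConst 1) (NVar vRun)) round.

Definition search : cmd := add_bounds;; NSet vRun (NConst 1);; rounds.

Definition cutting_plane : cmd :=
  search;;
  For vI vS (RSet aF (NVar vI) (RGet aP (NVar vI))).

(** * Adding a cut *)

Section AddCut.
Variables (R : realType) (ask : (nat -> R) -> nat -> R).
Variable T : R -> R -> Prop.
Implicit Types (st : state R) (cs : seq (R * R * R)).

Definition has_cuts cs st : Prop :=
  nvar st vM = size cs /\ forall j, (j < size cs)%N ->
  nth (0, 0, 0) cs j = (rarr st aHi j, rarr st aLo j, rarr st aRhs j).

Definition reg st a : R := rarr st a 0%N.

Definition new_cut st : R * R * R := (reg st sHi, reg st sLo, reg st sRhs).

Definition relaxed cs st : Prop :=
  has_cuts cs st /\ solves T cs (reg st sX) (reg st sD).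

Lemma runs_raise_gap e st (Q : state R -> Prop) :
  (forall D st', D = Num.max (reg st sD) (reval st e) -> reg st' sD = D ->
     framed (raise_gap e) st st' -> Q st') ->
  runs ask (raise_gap e) st 0 Q.
Proof.
move=> q; apply: (runs_weaken (Q := fun st' =>
    reg st' sD = Num.max (reg st sD) (reval st e) /\
    framed (raise_gap e) st st')); first by move=> st' [D1 fr]; apply: q fr.
apply: runs_framed; apply: runs_If => /= [le|].
  by apply: runs_Skip; rewrite (max_idPl le).
by rewrite -ltNge => /ltW le; apply: runs_RSet; rewrite (max_idPr le).
Qed.

Lemma runs_add_cut cs st : relaxed cs st ->
  let c := new_cut st in
  nonneg c -> valid T c -> 0 < c.1.1 + c.1.2 ->
  runs ask add_cut st 0 (relaxed (rcons cs c)).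
Proof.
move=> [[mE csE] sol] c nc vc c0.
do 3 (apply: runs_Seq0; apply: runs_RSet); rewrite /=.
set st1 := rupd _ _ _ _.
have [csD0 D0 Dle] := sol.
have new1 : new_cut st1 = c by [].
have x1 : reg st1 sX = reg st sX by [].
have D1 : reg st1 sD = reg st sD by [].
have m1 : nvar st1 vM = size cs by rewrite -mE.
have cs1 j : (j < size (rcons cs c))%N ->
    nth (0, 0, 0) (rcons cs c) j = (rarr st1 aHi j, rarr st1 aLo j, rarr st1 aRhs j).
  rewrite size_rcons ltnS nth_rcons /= /upd /= mE; case: ltngtP => // jm _.
  by rewrite csE.
(* The gap may rise as long as it stays below every gap in [T]. *)
pose gap_ok (D : R) := reg st sD <= D /\ forall hi lo, T hi lo -> D <= hi - lo.
apply: runs_Seq0; apply: runs_weaken (runs_framed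
  (_ : runs _ _ _ _ (fun st2 => gap_ok (reg st2 sD) /\
     (tilt c = 0 -> c.2 / c.1.1 <= reg st2 sD)))); last first.
  apply: runs_If => /= tc.
    have {}tc : tilt c = 0 by apply/eqP; rewrite eq_le.
    apply: runs_raise_gap => D st2 DE D2 fr.
    have {}DE : D = Num.max (reg st sD) (c.2 / c.1.1) by [].
    rewrite D2 DE; split; last by move=> _; rewrite le_max lexx orbT.
    split=> [|hi lo hl]; first by rewrite le_max lexx.
    by rewrite ge_max Dle //; have := vc _ _ hl; rewrite holds_flat.
  apply: runs_Skip; split; first by split.
  by move=> tc0; case/negP: tc; rewrite -eq_le; apply/eqP.
move=> st2 [[ok2 flat2] fr2]; apply: runs_Seq0.
have new2 : new_cut st2 = c by rewrite /new_cut /reg !fr2.2.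
pose Inv k st3 := [/\ gap_ok (reg st3 sD), reg st2 sD <= reg st3 sD &
  forall j, (j < k)%N -> tilt c * tilt (nth (0, 0, 0) cs j) < 0 ->
     pair_gap c (nth (0, 0, 0) cs j) <= reg st3 sD].
apply: (runs_For (Inv := Inv)); [by []|by []|by []|by split|..].
- move=> k st3; rewrite fr2.1 // m1 => km fr3 jk [ok3 D23 gaps3].
  have c'E : (rarr st3 aHi k, rarr st3 aLo k, rarr st3 aRhs k) = nth (0, 0, 0) cs k.
    by rewrite !fr3.2 // !fr2.2 // -cs1 ?size_rcons ?ltnS ?(ltnW km) // nth_rcons km.
  have new3 : new_cut st3 = c by rewrite -new2 /new_cut /reg !fr3.2.
  have [nc' vc' _] := csD0 _ (mem_nth (0, 0, 0) km).
  have [c' c'def] : exists c', nth (0, 0, 0) cs k = c' by eexists.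
  rewrite c'def in c'E nc' vc'.
  have opposed (b : bool) : b = (0 <= tilt c * tilt c') -> ~~ b = (tilt c * tilt c' < 0).
    by move=> ->; rewrite ltNge.
  apply: runs_If => /=; last first.
    rewrite (opposed _ _); last by rewrite -c'E -new3 /= jk.
    move=> opp; apply: runs_raise_gap => D st4 DE D4 fr4.
    have {}DE : D = Num.max (reg st3 sD) (pair_gap c c').
      by rewrite DE -c'E -new3 /= jk.
    have Dge : reg st3 sD <= D by rewrite DE le_max lexx.
    split; rewrite -[reg (nupd _ _ _) _]/(reg st4 sD) D4.
    + split=> [|hi lo hl]; first by apply: le_trans ok3.1 Dge.
      by rewrite DE ge_max ok3.2 // pair_gap_le ?vc ?vc'.
    + exact: le_trans D23 Dge.
    move=> j; rewrite ltnS leq_eqVlt => /predU1P[-> _|jk' opp'].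
      by rewrite c'def DE le_max lexx orbT.
    exact: le_trans (gaps3 j jk' opp') Dge.
  move=> same; apply: runs_Skip; split=> // j.
  rewrite ltnS leq_eqVlt => /predU1P[->|]; last exact: gaps3.
  by rewrite c'def -(opposed _ erefl) -c'E -new3 -jk => /negP.
move=> st3 [ok3 D23 gaps3] fr3; rewrite fr2.1 // m1 in gaps3.
have new3 : new_cut st3 = c by rewrite -new2 /new_cut /reg !fr3.2.
have x3 : reg st3 sX = reg st sX by rewrite -x1 /reg !fr3.2 ?fr2.2.
have sol3 : solves T (rcons cs c)
    (if holds c (reg st3 sX) (reg st3 sX - reg st3 sD) then reg st3 sX
     else (c.2 - c.1.2 * reg st3 sD) / tilt c) (reg st3 sD).
  rewrite x3; apply: solves_rcons (sol) nc vc c0 ok3.1 ok3.2 _ _.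
    by move=> c' /(nthP (0, 0, 0))[j jm <-]; apply: gaps3.
  by move=> tc; apply: le_trans (flat2 tc) D23.
have cuts3 j : (j < size (rcons cs c))%N ->
    nth (0, 0, 0) (rcons cs c) j = (rarr st3 aHi j, rarr st3 aLo j, rarr st3 aRhs j).
  by move=> jm; rewrite cs1 // !fr3.2 // !fr2.2.
have m3 : nvar st3 vM = size cs by rewrite fr3.1 // fr2.1.
apply: runs_Seq0; apply: runs_If => /= hold.
  apply/runs_Skip/runs_NSet; split.
    by split=> //=; rewrite /upd /= m3 addn1 size_rcons.
  move: sol3; rewrite -[X in if X then _ else _]/(_ <= _) -new3.
  by rewrite ifT.
apply/runs_RSet/runs_NSet; split.
  by split=> //=; rewrite /upd /= m3 addn1 size_rcons.
by move: sol3; rewrite -new3 ifN.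
Qed.

End AddCut.

(** * Correctness of the search *)

Section Correctness.
Variables (R : realType) (S : finType) (s0 : S) (I : instance R S).
Variable O : (S -> R) -> {set S}.
Hypotheses (wfI : wf_instance I) (oracleO : min_cost_oracle I O).
Let ask := ask_oracle O.
Let w := weight I.
Implicit Types (st : state R) (cs : seq (R * R * R)) (f : S -> R).

Definition elt (i : nat) : S := nth s0 (enum S) i.

Lemma encode_elt f i : (i < #|S|)%N -> encode f i = f (elt i).
Proof. by move=> iS; rewrite /encode (nth_map s0) // -cardE. Qed.

Lemma index_lt (s : S) : (index s (enum S) < #|S|)%N.
Proof. by rewrite cardE index_mem mem_enum. Qed.

Lemma elt_index (s : S) : elt (index s (enum S)) = s.
Proof. by rewrite /elt nth_index ?mem_enum. Qed.

Lemma sum_elt f : \sum_(0 <= i < #|S|) f (elt i) = \sum_s f s.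
Proof. by rewrite -[RHS]big_enum [RHS](big_nth s0) -cardE. Qed.

Definition has_input st : Prop :=
  nvar st vS = #|S| /\ forall a, (a < 7)%N -> rarr st a = rarr (input I) a.

Lemma has_input_framed P st st' : framed P st st' ->
  vS \notin nwrites P -> all (leq 7) (awrites P) -> has_input st -> has_input st'.
Proof.
move=> [fn fa] nP aP [n a]; split=> [|b b7]; first by rewrite fn.
by rewrite fa ?a //; apply: contraL b7 => /(allP aP); rewrite leqNgt.
Qed.

Lemma input_at st i : has_input st -> (i < #|S|)%N ->
  [/\ rarr st aF i = indicator R (Fstar I) (elt i), rarr st aC i = cost I (elt i),
      rarr st aW i = w (elt i) &
      [/\ rarr st aLfin i = (lower I (elt i) \is a fin_num)%:R,
          rarr st aL i = fine (lower I (elt i)),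
          rarr st aUfin i = (upper I (elt i) \is a fin_num)%:R &
          rarr st aU i = fine (upper I (elt i))]].
Proof.
by move=> [_ inE] iS; rewrite !inE //= !encode_elt.
Qed.

Lemma le1_nat_of_bool (b : bool) : (1 <= b%:R :> R) = b.
Proof. by case: b; rewrite ?lexx // ler10. Qed.

Let x_of st := reg st sX.
Let lo_of st := reg st sX - reg st sD.
Let dev_of st := dev I (x_of st) (lo_of st).

Lemma runs_build_deviation st (Q : state R -> Prop) : has_input st ->
  (forall st', framed build_deviation st st' ->
    (forall i, (i < #|S|)%N ->
      [/\ rarr st' aP i = dev_of st (elt i),
          rarr st' aRate i = rate I (x_of st) (lo_of st) (elt i) &
          rarr st' aQ i = cost I (elt i) - dev_of st (elt i)]) -> Q st') ->
  runs ask build_deviation st 0 Q.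
Proof.
move=> inp post.
pose Inv k st' := forall i, (i < k)%N ->
      [/\ rarr st' aP i = dev_of st (elt i),
          rarr st' aRate i = rate I (x_of st) (lo_of st) (elt i) &
          rarr st' aQ i = cost I (elt i) - dev_of st (elt i)].
apply: (runs_For (Inv := Inv)) => //; last first.
  by move=> st'; rewrite inp.1 => inv fr; apply: post inv.
move=> k st1; rewrite inp.1 => kS fr ik inv.
have x1 : x_of st1 = x_of st by rewrite /x_of /reg !fr.2.
have lo1 : lo_of st1 = lo_of st by rewrite /lo_of /reg !fr.2.
have := input_at (has_input_framed fr isT isT inp) kS.
set s := elt k => -[Fk Ck Wk [lk Lk uk Uk]].
have finish p r : p = dev_of st s -> r = rate I (x_of st) (lo_of st) s ->
    runs ask (RSet aQ (NVar vI) (RSub (RGet aC (NVar vI)) (RGet aP (NVar vI))))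
      (rupd (rupd st1 aP k p) aRate k r) 0
      (fun st3 => Inv k.+1 (nupd st3 vI k.+1)).
  move=> pE rE; apply: runs_RSet => i; rewrite ltnS leq_eqVlt /= ik /upd /=.
  case/predU1P=> [->|ki]; first by rewrite eqxx Ck pE rE.
  by rewrite (ltn_eqF ki); apply: inv.
have devE : dev_of st s = if s \in Fstar I
   then if capped I (x_of st) (lo_of st) s then fine (upper I s) else x_of st / w s
   else if capped I (x_of st) (lo_of st) s then fine (lower I s) else lo_of st / w s.
  by [].
have rateE : rate I (x_of st) (lo_of st) s =
    if capped I (x_of st) (lo_of st) s then 0 else (w s)^-1 by [].
have capE : capped I (x_of st) (lo_of st) s = if s \in Fstar I
    then (upper I s \is a fin_num) && (w s * fine (upper I s) <= x_of st)
    else (lower I s \is a fin_num) && (lo_of st <= w s * fine (lower I s)) by [].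
apply: runs_Seq0; apply: runs_If; rewrite /= ik Fk le1_nat_of_bool => sF.
  rewrite sF in devE capE; rewrite capE in devE rateE.
  have testE : beval st1 (BAnd (BLeR (num 1) (RGet aUfin (NVar vI)))
      (BLeR (RMul (RGet aW (NVar vI)) (RGet aU (NVar vI))) (get sX))) =
      (upper I s \is a fin_num) && (w s * fine (upper I s) <= x_of st).
    by rewrite -x1 /= ik uk le1_nat_of_bool Wk Uk.
  apply: runs_If; rewrite testE => cap; apply/runs_Seq0/runs_RSet/runs_RSet;
    rewrite /= ?ik /=; apply: finish.
  - by rewrite devE cap Uk.
  - by rewrite rateE cap.
  - by rewrite devE (negbTE cap) Wk -x1.
  - by rewrite rateE (negbTE cap) /upd /= Wk div1r.
rewrite (negbTE sF) in devE capE; rewrite capE in devE rateE.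
have testE : beval st1 (BAnd (BLeR (num 1) (RGet aLfin (NVar vI)))
    (BLeR (RSub (get sX) (get sD)) (RMul (RGet aW (NVar vI)) (RGet aL (NVar vI))))) =
    (lower I s \is a fin_num) && (lo_of st <= w s * fine (lower I s)).
  by rewrite -lo1 /= ik lk le1_nat_of_bool Wk Lk.
apply: runs_If; rewrite testE => cap; apply/runs_Seq0/runs_RSet/runs_RSet;
  rewrite /= ?ik /=; apply: finish.
- by rewrite devE cap Lk.
- by rewrite rateE cap.
- by rewrite devE (negbTE cap) Wk -lo1.
- by rewrite rateE (negbTE cap) /upd /= Wk div1r.
Qed.

Lemma runs_measure_answer hi lo F st (Q : state R -> Prop) : has_input st ->
  rarr st aAns = encode (indicator R F) ->
  (forall i, (i < #|S|)%N -> rarr st aRate i = rate I hi lo (elt i) /\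
      rarr st aQ i = cost I (elt i) - dev I hi lo (elt i)) ->
  (forall st', framed measure_answer st st' ->
     reg st' sHi = slope_hi I hi lo F -> reg st' sLo = slope_lo I hi lo F ->
     reg st' sRhs = viol I (dev I hi lo) F -> Q st') ->
  runs ask measure_answer st 0 Q.
Proof.
move=> inp ans rQ post; apply: (runs_weaken (Q := fun st' =>
  [/\ reg st' sHi = slope_hi I hi lo F, reg st' sLo = slope_lo I hi lo F &
      reg st' sRhs = viol I (dev I hi lo) F] /\ framed measure_answer st st')).
  by move=> st' [[hiE loE vE] fr]; apply: post.
apply: runs_framed; do 3 apply/runs_Seq0/runs_RSet.
rewrite /=; set st1 := rupd _ _ _ _.
pose ind (G : {set S}) (s : S) : R := indicator R G s.
pose fhi s := rate I hi lo s * (ind (Fstar I) s * (1 - ind F s)).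
pose flo s := rate I hi lo s * ((1 - ind (Fstar I) s) * ind F s).
pose fv s := (cost I s - dev I hi lo s) * (ind (Fstar I) s - ind F s).
pose Inv k st' := [/\ reg st' sHi = \sum_(0 <= i < k) fhi (elt i),
  reg st' sLo = \sum_(0 <= i < k) flo (elt i) &
  reg st' sRhs = \sum_(0 <= i < k) fv (elt i)].
have fr1 : framed measure_answer st st1.
  by split=> // a; rewrite /= !inE !negb_or /= /upd => /and5P[/negPf-> /negPf-> /negPf->].
apply: (runs_For (Inv := Inv)) => //; first by split; rewrite big_geq.
  move=> k st2; rewrite /= inp.1 => kS fr ik [hiE loE vE].
  have := input_at (has_input_framed fr isT isT (has_input_framed fr1 isT isT inp)) kS.
  have [rk qk] := rQ k kS; have ak := encode_elt (indicator R F) kS.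
  rewrite -ans in ak.
  have r2 : rarr st2 aRate k = rarr st aRate k by rewrite fr.2.
  have q2 : rarr st2 aQ k = rarr st aQ k by rewrite fr.2.
  have a2 : rarr st2 aAns k = rarr st aAns k by rewrite fr.2.
  case=> Fk _ _ _; apply/runs_Seq0/runs_RSet/runs_Seq0/runs_RSet/runs_RSet => /=.
  rewrite ik /upd /= in Fk *.
  by split; rewrite big_nat_recr //= /reg /= /upd /= Fk ?r2 ?q2 ?a2 ?rk ?qk ?ak
     -?hiE -?loE -?vE.
move=> st' [hiE loE vE] fr; rewrite inp.1 !sum_elt in hiE loE vE.
by split; rewrite ?hiE ?loE ?vE.
Qed.

Let T := attainable I.

(** The bounds at [s] enter the relaxation as cuts of slopes [(1, 0)] and
    [(0, 1)]: they make [dev] feasible, which cuts given by solutions do not. *)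
Definition bounds_in cs (s : S) : Prop :=
  (lower I s \is a fin_num -> (1, 0, w s * fine (lower I s)) \in cs) /\
  (upper I s \is a fin_num -> (0, 1, - (w s * fine (upper I s))) \in cs).

Lemma runs_add_bound b a1 a2 e r cs st : relaxed T cs st ->
  (beval st b -> valid T (a1%:R, a2%:R, r)) -> (0 < a1 + a2)%N ->
  reval (rupd (rupd st sHi 0 a1%:R) sLo 0 a2%:R) e = r ->
  runs ask (If b (set sHi (num a1);; set sLo (num a2);; set sRhs e;; add_cut) Skip)
    st 0
    (fun st' => exists cs', [/\ relaxed T cs' st', {subset cs <= cs'} &
                               beval st b -> (a1%:R, a2%:R, r) \in cs']).
Proof.
move=> rel vc a0 re; apply: runs_If => bt; last first.
  by apply: runs_Skip; exists cs; split=> // bt'; rewrite bt' in bt.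
do 3 apply/runs_Seq0/runs_RSet; rewrite /= re.
set st1 := rupd _ _ _ _.
have rel1 : relaxed T cs st1 by exact: rel.
have cE : new_cut st1 = (a1%:R, a2%:R, r) by [].
have := runs_add_cut ask rel1; rewrite cE => /(_ _ (vc bt) _) add.
apply: runs_weaken (add _ _).
- move=> st2 rel2; exists (rcons cs (a1%:R, a2%:R, r)); split=> //.
    by move=> c ccs; rewrite mem_rcons inE ccs orbT.
  by rewrite mem_rcons mem_head.
- by rewrite /nonneg /= !ler0n.
by rewrite /= -natrD ltr0n.
Qed.

Lemma runs_add_bounds st (Q : state R -> Prop) :
  has_input st -> relaxed T [::] st ->
  (forall st' cs, framed add_bounds st st' -> relaxed T cs st' ->
     (forall s, bounds_in cs s) -> Q st') ->
  runs ask add_bounds st 0 Q.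
Proof.
move=> inp rel post.
pose Inv k st' := exists2 cs, relaxed T cs st' &
  forall i, (i < k)%N -> bounds_in cs (elt i).
apply: (runs_For (Inv := Inv)) => //; last first.
- move=> st' [cs rel' bnd] fr; apply: post fr rel' _ => s.
  by rewrite -(elt_index s); apply: bnd; rewrite inp.1 index_lt.
- move=> k st1; rewrite inp.1 => kS fr ik [cs rel1 bnd].
  have inp1 := has_input_framed fr isT isT inp.
  have [_ _ Wk [lk Lk uk Uk]] := input_at inp1 kS.
  have vlow : lower I (elt k) \is a fin_num ->
      valid T (1%:R, 0%:R, w (elt k) * fine (lower I (elt k))).
    move=> lf hi lo [q [_ qI] qw]; rewrite /holds /= mul1r mul0r subr0.
    have /andP[+ _] := qI (elt k); rewrite -{1}(fineK lf) lee_fin => lq.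
    have /andP[_] := qw (elt k); apply: le_trans.
    by rewrite ler_wpM2l // ltW // weight_gt0.
  have vup : upper I (elt k) \is a fin_num ->
      valid T (0%:R, 1%:R, - (w (elt k) * fine (upper I (elt k)))).
    move=> uf hi lo [q [_ qI] qw]; rewrite /holds /= mul1r mul0r sub0r lerN2.
    have /andP[_] := qI (elt k); rewrite -{1}(fineK uf) lee_fin => qu.
    have /andP[+ _] := qw (elt k) => /le_trans; apply.
    by rewrite ler_wpM2l // ltW // weight_gt0.
  apply: runs_Seq0; apply: runs_weaken (runs_framed (runs_add_bound
    (r := w (elt k) * fine (lower I (elt k))) rel1 _ _ _)) => //=.
  + move=> st2 [[cs2 [rel2 sub2 low2]] fr2].
    have inp2 := has_input_framed fr2 isT isT inp1.
    have [_ _ Wk2 [lk2 Lk2 uk2 Uk2]] := input_at inp2 kS.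
    have ik2 : nvar st2 vI = k by rewrite fr2.1.
    apply: runs_weaken (runs_add_bound
      (r := - (w (elt k) * fine (upper I (elt k)))) rel2 _ _ _) => //=.
    * move=> st3 [cs3 [rel3 sub3 up3]]; exists cs3 => // i.
      rewrite ltnS leq_eqVlt => /predU1P[->|/bnd[low1 up1]]; last first.
        by split=> [/low1|/up1] /sub2/sub3.
      split=> [lf|uf].
        by apply/sub3/low2; rewrite ik lk le1_nat_of_bool.
      by apply: up3; rewrite ik2 uk2 le1_nat_of_bool.
    * by rewrite ik2 uk2 le1_nat_of_bool.
    by rewrite ik2 /upd /= Wk2 Uk2 sub0r.
  + by rewrite ik lk le1_nat_of_bool.
  by rewrite ik /upd /= Wk Lk.
by exists [::].
Qed.

Definition finished st : Prop := nvar st vRun = 0%N /\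
  ((has_input st /\ exists2 p, optimal s0 I p &
      forall i, (i < #|S|)%N -> rarr st aP i = p (elt i)) \/
   (nvar st vS = 0%N /\ ~ exists p, feasible I p)).

Variable N : nat.
Hypothesis wnormN : wnorm I = N%:R.

(** The slopes of the cuts given by solutions are recorded in [tried], apart
    from those of the bounds, which count for no oracle call. *)
Definition searching (tried : seq (R * R)) st : Prop :=
  [/\ has_input st, nvar st vRun = 1%N, uniq tried,
      {subset tried <= slope_grid R N} &
      exists cs, [/\ relaxed T cs st, forall s, bounds_in cs s &
        forall t, t \in tried -> exists2 c, c \in cs & c.1 = t /\ dominant I c]].

Lemma searching_bound tried st : searching tried st -> (size tried <= N.+1 ^ 2)%N.
Proof.
move=> [_ _ un sub _]; apply: leq_trans (uniq_leq_size un sub) _.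
by rewrite /slope_grid size_allpairs size_iota mulnn.
Qed.

(** A round that does not settle the instance finds slopes outside [tried]: a
    stored dominant cut with the slopes of the new one would be at least as
    strong, and the current pair satisfies all stored cuts. *)
Lemma runs_round tried st : searching tried st ->
  runs ask round st 1
    (fun st' => finished st' \/ exists t, searching (t :: tried) st').
Proof.
move=> [inp run un sub [cs [rel bnd dom]]].
have [[mE csE] [csP D0 Dle]] := rel.
pose x := x_of st; pose lo := lo_of st.
apply: runs_Seq0; apply: runs_build_deviation => // st1 fr1 dev1.
apply: (@runs_Seq _ _ _ _ _ 1 0); apply: runs_Query.
set st2 := aupd _ _ _; set F := O (Defs.decode S (rarr st1 aQ)).
have fr2 : framed (Query aQ aAns) st1 st2.
  by split=> // a; rewrite /= inE /upd => /negPf->.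
have inp2 := has_input_framed fr2 isT isT (has_input_framed fr1 isT isT inp).
apply: runs_Seq0; apply: (@runs_measure_answer x lo F) => //.
  by move=> i iS; have [_ re qe] := dev1 i iS; rewrite !fr2.2.
move=> st3 fr3 hi3 lo3 v3.
have inp3 := has_input_framed fr3 isT isT inp2.
have run3 : nvar st3 vRun = 1%N by rewrite fr3.1 // fr2.1 // fr1.1.
have p3 i : (i < #|S|)%N -> rarr st3 aP i = dev I x lo (elt i).
  by move=> iS; rewrite fr3.2 // fr2.2 //; have [-> _ _] := dev1 i iS.
have vsumE F' : vsum (Defs.decode S (rarr st1 aQ)) F' =
    vsum (fun s => cost I s - dev I x lo s) F'.
  apply: eq_bigr => s _; rewrite /Defs.decode.
  by have [_ _ ->] := dev1 _ (index_lt s); rewrite elt_index.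
have FI : F \in feas I by have [] := oracleO (Defs.decode S (rarr st1 aQ)).
have Fmax F' : F' \in feas I -> viol I (dev I x lo) F' <= viol I (dev I x lo) F.
  move=> F'I; rewrite !violE lerD2l lerN2 -!vsumE.
  by have [_ ->] := oracleO (Defs.decode S (rarr st1 aQ)).
have same a : a \in [:: aHi; aLo; aRhs; sD; sX] -> rarr st3 a = rarr st a.
  move=> ain; rewrite fr3.2 ?fr2.2 ?fr1.2 //.
  + by move: a ain; apply/allP.
  + by move: a ain; apply/allP.
  by move: a ain; apply/allP.
have rel3 : relaxed T cs st3.
  split; last by rewrite /reg !same.
  split=> [|j jm]; first by rewrite fr3.1 // fr2.1 // fr1.1.
  by rewrite csE // !same.
have x3 : x_of st3 = x by rewrite /x_of /reg same.
have lo3' : lo_of st3 = lo by rewrite /lo_of /reg !same.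
apply: runs_If => /= vle.
  apply: runs_NSet; left; split=> //; left; split.
    exact: inp3.
  exists (dev I x lo); last exact: p3.
  apply: optimal_dev => //.
  - move=> s lf; have [/(_ lf)/csP[_ _] + _] := bnd s.
    by rewrite /holds /= mul1r mul0r subr0.
  - move=> s uf; have [_ /(_ uf)/csP[_ _]] := bnd s.
    by rewrite /holds /= mul1r mul0r sub0r lerN2.
  move=> F' F'I; apply: le_trans (Fmax F' F'I) _.
  by rewrite -v3; exact: vle.
have viol0 : 0 < viol I (dev I x lo) F by rewrite -v3 ltNge; exact: vle.
pose c := cut I x lo F.
have nc : nonneg c := nonneg_cut wfI x lo F.
have vc : valid T c := valid_cut wfI x lo FI.
apply: runs_If => /=.
  rewrite -[rarr st3 sHi 0]/(reg st3 sHi) -[rarr st3 sLo 0]/(reg st3 sLo) hi3 lo3.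
  move=> c0; apply/runs_Seq0/runs_NSet/runs_NSet; left; split=> //; right.
  split=> // -[q fq]; have [h [l [hl _]]] := attainable_span s0 fq.
  have := vc _ _ hl; rewrite /holds /=.
  have [h0 l0] : slope_hi I x lo F = 0 /\ slope_lo I x lo F = 0.
    by move: nc => /andP[/= h0 l0]; split; lra.
  by rewrite h0 l0 !mul0r subrr addr0 subr0 leNgt viol0.
(* The slopes are nonnegative and not both [0]. *)
rewrite -[rarr st3 sHi 0]/(reg st3 sHi) -[rarr st3 sLo 0]/(reg st3 sLo) hi3 lo3.
rewrite -ltNge => c0.
apply/runs_Seq0/runs_RSet; set st4 := rupd _ _ _ _.
have rel4 : relaxed T cs st4 by exact: rel3.
have c4 : new_cut st4 = c.
  rewrite /new_cut /c /cut -hi3 -lo3 -v3 -x3 -lo3'.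
  by rewrite /reg /=.
have := runs_add_cut ask rel4; rewrite c4 => /(_ nc vc c0) add.
apply: runs_weaken (runs_framed add) => st5 [rel5 fr5].
right; exists c.1; split.
- apply: has_input_framed fr5 isT isT _.
  apply: has_input_framed (_ : framed (set sRhs (num 0)) st3 st4) isT isT inp3.
  by split=> // a; rewrite /= inE /upd => /negPf->.
- by rewrite fr5.1.
- rewrite /= un andbT; apply/negP => /dom[c' c'cs [c'E domc']].
  have := domc' x lo F FI (esym c'E) => le_c.
  have [_ _] := csP c' c'cs.
  have : ~~ holds c x lo by rewrite holds_cut -ltNge.
  rewrite /holds c'E => /negP nh h; apply: nh; apply: le_trans le_c h.
- move=> t; rewrite inE => /predU1P[->|/sub//].
  exact: (grid_slopes wfI).
exists (rcons cs c); split=> //.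
  move=> s; have [l u] := bnd s.
  by split=> [/l|/u] h; rewrite mem_rcons inE h orbT.
move=> t; rewrite inE => /predU1P[->|/dom[c' c'cs h]].
  by exists c; rewrite ?mem_rcons ?mem_head //; split=> //; apply: dominant_cut.
by exists c' => //; rewrite mem_rcons inE c'cs orbT.
Qed.

Lemma runs_rounds tried st : searching tried st ->
  exists2 k, (k <= (N.+1 ^ 2 - size tried).+1)%N & runs ask rounds st k finished.
Proof.
move nE: (N.+1 ^ 2 - size tried)%N => n.
elim: n tried st nE => [|n IH] tried st nE srch;
  have run := let: And5 _ r _ _ _ := srch in r;
  have [st1 e1 [fin|[t srch1]]] := runs_round srch.
- exists 1%N => //; exists st1 => //; apply: (@ExecWhileTrue _ _ _ _ _ 1 st1 0) => //.
    by rewrite /= run.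
  by apply: ExecWhileFalse; rewrite /= fin.1.
- have := searching_bound srch1; rewrite /= ltnNge.
  by rewrite -subn_eq0 nE.
- exists 1%N => //; exists st1 => //; apply: (@ExecWhileTrue _ _ _ _ _ 1 st1 0) => //.
    by rewrite /= run.
  by apply: ExecWhileFalse; rewrite /= fin.1.
have [|k kn [st2 e2 fin2]] := IH (t :: tried) st1 _ srch1.
  by rewrite /= subnS nE.
exists (1 + k)%N; first by rewrite ltnS.
by exists st2 => //; apply: ExecWhileTrue e1 e2; rewrite /= run.
Qed.

Lemma runs_cutting_plane :
  exists2 k, (k <= (N.+1 ^ 2).+1)%N &
    runs ask cutting_plane (input I) k (fun st => correct_output s0 I (output S st)).
Proof.
have inp0 : has_input (input I) by [].
have rel0 : relaxed T [::] (input I).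
  split=> //; split=> // hi lo [q _ qw]; rewrite /reg /= subr_ge0.
  by have /andP[/le_trans] := qw s0; apply.
have : exists2 k, (k <= (N.+1 ^ 2).+1)%N &
    runs ask search (input I) k finished.
  have [st [cs [fr rel bnd]] e] : exists2 st, exists cs,
      [/\ framed add_bounds (input I) st, relaxed T cs st & forall s, bounds_in cs s]
      & exec ask add_bounds (input I) 0 st.
    have [st e [cs h]] : runs ask add_bounds (input I) 0 (fun st => exists cs,
      [/\ framed add_bounds (input I) st, relaxed T cs st & forall s, bounds_in cs s]).
      by apply: runs_add_bounds => // st' cs fr rel bnd; exists cs.
    by exists st => //; exists cs.
  have srch : searching [::] (nupd st vRun 1).
    split=> //; first exact: has_input_framed fr isT isT inp0.
    by exists cs; split.
  have [k kn run] := runs_rounds srch; exists k; first by move: kn; rewrite subn0.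
  by apply: runs_Seq0; exists st => //; apply/runs_Seq0/runs_NSet.
case=> k kn [st e [_ fin]]; exists k => //.
have [st' e' ok] : runs ask (For vI vS (RSet aF (NVar vI) (RGet aP (NVar vI)))) st 0
    (fun st => correct_output s0 I (output S st)).
  case: fin => [[inp [p opt pE]]|[n0 inf]]; last first.
    apply: (runs_For (Inv := fun _ _ => True)) => // [k1 st1|st' _ fr].
      by rewrite n0.
    by rewrite /output fr.1 // n0.
  pose Inv k st' := forall i, (i < k)%N -> rarr st' aF i = p (elt i).
  apply: (runs_For (Inv := Inv)) => //.
    move=> k1 st1; rewrite inp.1 => kS fr ik inv; apply: runs_RSet => i.
    rewrite ltnS leq_eqVlt /= ik /upd /= => /predU1P[->|ik1].
      by rewrite eqxx fr.2 // pE.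
    by rewrite (ltn_eqF ik1) inv.
  move=> st'; rewrite inp.1 => inv fr; rewrite /output fr.1 // inp.1.
  have S0 : (0 < #|S|)%N by apply/card_gt0P; exists s0.
  rewrite (gtn_eqF S0) /=; suff -> : Defs.decode S (rarr st' aF) = p by [].
  by apply: boolp.funext => s; rewrite /Defs.decode inv ?index_lt // elt_index.
by exists st' => //; rewrite -[k]addn0; apply: ExecSeq e e'.
Qed.

End Correctness.

Theorem corollary11 :
  exists (P : cmd) (C : nat),
    forall (R : realType) (S : finType) (s0 : S) (I : instance R S)
           (O : (S -> R) -> {set S}),
      wf_instance I -> min_cost_oracle I O ->
      exists (k : nat) (st : state R),
        [/\ exec (ask_oracle O) P (input I) k st,
            k%:R <= C%:R * #|S|%:R ^+ 2 * wnorm I ^+ 6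
          & correct_output s0 I (output S st)].
Proof.
exists cutting_plane, 5%N => R S s0 I O wfI oracleO.
have /natrP[N WN] := wnorm_nat wfI.
have [k kN [st e ok]] := runs_cutting_plane s0 wfI oracleO WN.
exists k, st; split=> //; rewrite WN -!natrX -!natrM ler_nat.
have S0 : (0 < #|S|)%N by apply/card_gt0P; exists s0.
have N0 : (0 < N)%N.
  rewrite -(ltr_nat R) -WN /wnorm (bigD1 s0) //= ltr_wpDr //.
    by apply: sumr_ge0 => s _; rewrite invr_ge0 ltW ?weight_gt0.
  by rewrite invr_gt0 weight_gt0.
apply: (leq_trans kN); apply: (@leq_trans (5 * N ^ 2)).
  by rewrite -!mulnn; nia.
rewrite -mulnA leq_pmul2l //; apply: (@leq_trans (N ^ 6)).
  by rewrite leq_pexp2l.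
by rewrite leq_pmull // expn_gt0 S0.
Qed.
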